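(* Let $R$ be a commutative ring, $k$ a positive integer, $\alpha\in R$, and $I$ an ideal of $R$ with $\{0\}\neq I\neq R$. Let $\bar{\ }:R\to R/I$ be the canonical projection, let $\mathfrak{M}=\mathfrak{M}(k,R,\alpha)$, and let $\bar{\mathfrak{M}}=\{(\bar N,\bar M):(N,M)\in\mathfrak{M}\}$. Let $A$ and $B$ be two $\bar\alpha$-circulant $k\times k$ matrices over $R/I$ which are in the same $\bar{\mathfrak{M}}$-orbit. Then for each lift of $A$ there is a lift of $B$ which is in the same $\mathfrak{M}$-orbit.
   Context: For a commutative ring $S$ and $\alpha\in S$, a $k\times k$ matrix over $S$ is $\alpha$-circulant if, for some $(a_0,\ldots,a_{k-1})\in S^k$ and with rows and columns indexed from $0$, its $(i,j)$ entry is $a_{j-i}$ if $j\ge i$ and $\alpha a_{k+j-i}$ if $j<i$. An invertible $k\times k$ matrix over $S$ is monomial if it is the product of a permutation matrix and an invertible diagonal matrix. $\mathfrak{M}(k,S,\alpha)$ is the set of all pairs $(N,M)$ of monomial $k\times k$ matrices over $S$ such that for every $\alpha$-circulant $A\in S^{k\times k}$ the matrix $N^{-1}AM$ is again $\alpha$-circulant. A pair $(N,M)$ is viewed as the map $A\mapsto N^{-1}AM$; composition of maps gives the group structure on $\mathfrak{M}$ and its action on the set of $\alpha$-circulant matrices. Thus $X,Y$ are in the same $\mathfrak{M}$-orbit if $Y=N^{-1}XM$ for some $(N,M)\in\mathfrak{M}$. Bars on matrices denote entrywise reduction modulo $I$; one has $\bar{\mathfrak{M}}\subseteq\mathfrak{M}(k,R/I,\bar\alpha)$,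 and $\bar{\mathfrak{M}}$ acts on the $\bar\alpha$-circulant matrices over $R/I$ in the same way (so $A,B$ are in the same $\bar{\mathfrak{M}}$-orbit if $B=\bar N^{-1}A\bar M$ for some $(N,M)\in\mathfrak{M}$). A lift of an $\bar\alpha$-circulant matrix $A$ over $R/I$ is an $\alpha$-circulant matrix $L$ over $R$ with $\bar L=A$. *)

(* Defs.v *)
From HB Require Import structures.
From mathcomp Require Import all_boot all_algebra all_fingroup.
From mathcomp Require Import boolp classical_sets.

Set Implicit Arguments.
Unset Strict Implicit.
Unset Printing Implicit Defensive.

Import GRing.Theory.
Local Open Scope ring_scope.
Local Open Scope classical_set_scope.

Section Matrices.
Variables (S : comNzRingType) (k : nat).
Implicit Types (A B N M X Y : 'M[S]_k) (G : set ('M[S]_k * 'M[S]_k)).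

Definition is_inverse N P : Prop := N *m P = 1%:M /\ P *m N = 1%:M.

Definition invertible N : Prop := exists P, is_inverse N P.

(* The library's invmx needs a comUnitRingType, a structure that the quotient
   by an arbitrary ideal does not carry.  As for invmx, the value at a matrix
   that is not invertible is the matrix itself. *)
Definition mxinv N : 'M[S]_k := xget N [set P | is_inverse N P].

Lemma mxinvE N P : is_inverse N P -> mxinv N = P.
Proof.
move=> NP; apply: xget_unique => //= Q [_ QN].
by case: NP => NP _; rewrite -[Q]mulmx1 -NP mulmxA QN mul1mx.
Qed.

Lemma mxinvP N : invertible N -> is_inverse N (mxinv N).
Proof. by case=> P NP; rewrite (mxinvE NP). Qed.

Definition circulant (alpha : S) A : Prop :=
  exists a : k.-tuple S, forall i j : 'I_k,
    A i j = if (i <= j)%N then a`_(j - i) else alpha * a`_(k + j - i).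

Definition monomial N : Prop :=
  invertible N /\
  exists (s : 'S_k) (d : 'rV[S]_k),
    invertible (diag_mx d) /\ N = perm_mx s *m diag_mx d.

Definition monomial_pairs (alpha : S) : set ('M[S]_k * 'M[S]_k) :=
  [set NM | [/\ monomial NM.1, monomial NM.2 &
    forall A, circulant alpha A -> circulant alpha (mxinv NM.1 *m A *m NM.2)]].

Definition same_orbit G X Y : Prop :=
  exists2 NM, G NM & Y = mxinv NM.1 *m X *m NM.2.

End Matrices.

Arguments monomial_pairs {S} k alpha _.

Lemma mxinv_invmx (S : comUnitRingType) (k : nat) (N : 'M[S]_k) :
  N \in unitmx -> mxinv N = invmx N.
Proof. by move=> uN; apply: mxinvE; split; rewrite ?mulmxV ?mulVmx. Qed.

Section Reduction.
Variables (R : comNzRingType) (I : idealr R) (k : nat).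

Definition red (x : R) : {ideal_quot I} := (\pi_{ideal_quot I} x)%qT.

Definition redmx (A : 'M[R]_k) : 'M[{ideal_quot I}]_k := map_mx red A.

Definition monomial_pairs_red (alpha : R) :
    set ('M[{ideal_quot I}]_k * 'M[{ideal_quot I}]_k) :=
  [set (redmx NM.1, redmx NM.2) | NM in monomial_pairs k alpha].

Definition is_lift (alpha : R) (A : 'M[{ideal_quot I}]_k) (L : 'M[R]_k) : Prop :=
  circulant alpha L /\ redmx L = A.

End Reduction.

Arguments monomial_pairs_red {R} I k alpha _.

(* Main.v *)
Require Import Defs.
From HB Require Import structures.
From mathcomp Require Import all_boot all_algebra all_fingroup.
From mathcomp Require Import boolp classical_sets.

Set Implicit Arguments.
Unset Strict Implicit.
Unset Printing Implicit Defensive.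

Import GRing.Theory.
Local Open Scope ring_scope.

(** A pair over [R/I] carrying [A] to [B] is by definition the reduction of some [(N, M)] over [R].
    Applying [(N, M)] itself to [L] stays among the circulants, and the result reduces to [B] since
    reduction respects products ([redmxM]) and inverses ([mxinv_red]). *)

Lemma redmxM (R : comNzRingType) (I : idealr R) (k : nat) (X Y : 'M[R]_k) :
  redmx I (X *m Y) = redmx I X *m redmx I Y.
Proof. exact: (map_mxM (\pi_{ideal_quot I})%qT). Qed.

Lemma redmx1 (R : comNzRingType) (I : idealr R) (k : nat) :
  redmx I (1%:M : 'M_k) = 1%:M.
Proof. exact: (map_mx1 (\pi_{ideal_quot I})%qT). Qed.

(** A ring morphism maps a two-sided inverse to one, and inverses are unique. If only [redmx I N]
    were invertible, [mxinv N] would be the default [N]. *)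
Lemma mxinv_red (R : comNzRingType) (I : idealr R) (k : nat) (N : 'M[R]_k) :
  invertible N -> mxinv (redmx I N) = redmx I (mxinv N).
Proof.
by move=> /mxinvP[NV VN]; apply: mxinvE; split; rewrite -redmxM ?NV ?VN redmx1.
Qed.

(* idealr R contains the condition that 1 is not in I, that is I <> R. *)
Theorem lemma4p1 (R : comNzRingType) (k : nat) (k_gt0 : (0 < k)%N) (alpha : R)
    (I : idealr R) (I_neq0 : exists2 x : R, x \in I & x != 0)
    (A B : 'M[{ideal_quot I}]_k)
    (circA : circulant (red I alpha) A) (circB : circulant (red I alpha) B)
    (AB : same_orbit (monomial_pairs_red I k alpha) A B) :
  forall L : 'M[R]_k, is_lift alpha A L ->
  exists2 L' : 'M[R]_k, is_lift alpha B L' &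
    same_orbit (monomial_pairs k alpha) L L'.
Proof.
move=> L [circL redL]; case: AB => _ [[N M] NM_pair <-] /= defB.
have [[invN _] _ stable] := NM_pair.
exists (mxinv N *m L *m M); last by exists (N, M).
(* The rewriting leaves [defB], and [invN] as side condition. *)
by split; [exact: stable | rewrite !redmxM redL -mxinv_red].
Qed.
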